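(* (Dual Orlicz-Brunn-Minkowski inequality for the Orlicz harmonic addition) Let $L_1,K_1,\ldots,K_n\in\mathcal S^n$ and $\phi\in\mathcal C$. Then for every $\varepsilon>0$, $$\phi(1)\ \ge\ \phi\left(\frac{\widetilde V(K_1,\ldots,K_n)}{\widetilde V(K_1\widehat+_\phi\varepsilon\cdot L_1,K_2,\ldots,K_n)}\right)+\varepsilon\,\phi\left(\frac{\widetilde V(L_1,K_2,\ldots,K_n)}{\widetilde V(K_1\widehat+_\phi\varepsilon\cdot L_1,K_2,\ldots,K_n)}\right).$$ If $\phi$ is strictly convex, equality holds if and only if $K_1$ and $L_1$ are dilates.
   Context: $\mathcal S^n$ is the set of star bodies (about the origin) in $\mathbb R^n$: compact sets $K$, star-shaped with respect to the origin, whose radial function $\rho(K,u)=\max\{c\ge 0: cu\in K\}$, $u\in S^{n-1}$, is positive and continuous. Two star bodies $K,L$ are dilates if $\rho(K,u)/\rho(L,u)$ is independent of $u\in S^{n-1}$. $S$ denotes spherical Lebesgue measure on $S^{n-1}$. $\mathcal C$ is the class of convex, decreasing functions $\phi:(0,\infty)\to(0,\infty)$ with $\lim_{t\to 0^+}\phi(t)=\infty$ (convention $\phi(0)=\infty$) and $\lim_{t\to\infty}\phi(t)=0$. The dual mixed volume of $K_1,\ldots,K_n\in\mathcal S^n$ is $\widetilde V(K_1,\ldots,K_n)=\frac1n\int_{S^{n-1}}\rho(K_1,u)\cdots\rho(K_n,u)\,dS(u)$. For $K,L\in\mathcal S^n$ and $\varepsilon\ge 0$, the Orlicz harmonic linear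 combination $K\widehat+_\phi\varepsilon\cdot L$ is the star body $M$ whose radial function is determined by $$\phi\left(\frac{\rho(K,u)}{\rho(M,u)}\right)+\varepsilon\,\phi\left(\frac{\rho(L,u)}{\rho(M,u)}\right)=\phi(1),\qquad u\in S^{n-1}.$$ *)

(* Defs.v *)
From HB Require Import structures.
From mathcomp Require Import all_boot all_order all_algebra.
From mathcomp Require Import all_classical all_reals all_analysis.
From mathcomp Require Import measurable_realfun.

Set Implicit Arguments.
Unset Strict Implicit.
Unset Printing Implicit Defensive.

Import Order.TTheory GRing.Theory Num.Theory.
Import numFieldNormedType.Exports.

Local Open Scope classical_set_scope.
Local Open Scope ring_scope.

(* The library norm `|x| on 'rV[R]_n is the sup norm; it induces the same
   topology as the Euclidean norm below. *)
Definition enorm (R : realType) (n : nat) (x : 'rV[R]_n) : R :=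
  Num.sqrt (\sum_(i < n) x 0 i ^+ 2).

Definition sphere (R : realType) (n : nat) : set 'rV[R]_n :=
  [set u | enorm u = 1].
Arguments sphere {R n}.

(* R^n with its Borel sigma-algebra *)
Notation Rn R n := (g_sigma_algebraType (@open 'rV[R]_n)).

Section lebesgue_rV.
Context {R : realType}.

Lemma measurable_open_rV n (U : set 'rV[R]_n) :
  open U -> measurable (U : set (Rn R n)).
Proof. exact: sub_sigma_algebra. Qed.

Lemma measurable_continuous_rV n (f : 'rV[R]_n -> R) :
  continuous f -> measurable_fun [set: Rn R n] f.
Proof.
move=> cf; apply: (measurability _ (RGenOInfty.measurableE R)).
move=> _ [_ [a ->] <-]; rewrite setTI; apply: measurable_open_rV.
by move/continuousP : cf; apply; exact: interval_open.
Qed.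

Let cube (n : nat) (p : {ffun 'I_n -> rat} * nat) : set 'rV[R]_n :=
  [set y | forall i, `|ratr (p.1 i) - y 0 i| < p.2.+1%:R^-1].

Let cubes_cover n (U : set 'rV[R]_n) : open U ->
  U = \bigcup_p (if `[< cube p `<=` U >] then cube p else set0 : set 'rV[R]_n).
Proof.
move=> oU; rewrite eqEsubset; split; last first.
  by move=> y [p _]; case: ifPn => // /asboolP; exact.
move=> x Ux; have := open_nbhs_nbhs (conj oU Ux).
rewrite -nbhs_ballE => -[e/= e0 xeU].
have [k ke] : exists k : nat, k.+1%:R^-1 < e / 2.
  have e20 : 0 < e / 2 by rewrite divr_gt0.
  by have [k _ /(_ _ (leqnn k))] := near_infty_natSinv_lt (PosNum e20); exists k.
have /choice[q qx] : forall i : 'I_n, exists q : rat,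
    `|ratr q - x 0 i| < k.+1%:R^-1 :> R.
  move=> i; have [|q] := @rat_in_itvoo R (x 0 i - k.+1%:R^-1) (x 0 i + k.+1%:R^-1).
    by rewrite ltrBlDr -addrA ltrDl addr_gt0// invr_gt0.
  by rewrite in_itv/= => qx; exists q; rewrite ltr_distl.
exists ([ffun i => q i], k) => //.
rewrite ifT; first by move=> i/=; rewrite ffunE.
apply/asboolP => y /= yq; apply: xeU; split => // i j.
rewrite /ball/= (ord1 i) (le_lt_trans (ler_distD (ratr (q j)) _ _))//.
rewrite [ltRHS](splitr e) ltrD//.
  by rewrite distrC (lt_trans (qx j)).
by rewrite (lt_trans _ ke)//; have := yq j; rewrite ffunE.
Qed.

(* the Borel sigma-algebra of R^n is generated by the coordinates *)
Lemma measurable_fun_rV d (T : measurableType d) n (f : T -> Rn R n) :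
  (forall i, measurable_fun setT (fun t => (f t : 'rV[R]_n) 0 i)) ->
  measurable_fun setT f.
Proof.
move=> mf; apply: (@measurability _ _ T (Rn R n) setT f (@open 'rV[R]_n)) => //.
move=> _ [U oU <-]; rewrite setTI (cubes_cover oU) preimage_bigcup.
apply: countable_bigcupT_measurable; first exact: countableP.
move=> [q k]; case: ifPn => _; last by rewrite preimage_set0.
rewrite [X in measurable X](_ : _ = \bigcap_(i in [set: 'I_n])
    (fun t => (f t : 'rV[R]_n) 0 i) @^-1` ball (ratr (q i) : R) k.+1%:R^-1); last first.
  by rewrite eqEsubset; split => t /= h i; [move=> _|]; exact: h.
apply: fin_bigcap_measurable => // i _; rewrite -[X in measurable X]setTI.
apply: mf => //; exact: measurable_ball.
Qed.

Definition rV_cons n (p : measurableTypeR R * Rn R n) : Rn R n.+1 :=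
  \row_i (if unlift ord0 i is Some j then (p.2 : 'rV[R]_n) 0 j else p.1).

Let rV_uncons n (x : Rn R n.+1) : measurableTypeR R * Rn R n :=
  ((x : 'rV[R]_n.+1) 0 ord0, \row_j (x : 'rV[R]_n.+1) 0 (lift ord0 j)).

Lemma measurable_rV_coord n i :
  measurable_fun [set: Rn R n] (fun x => (x : 'rV[R]_n) 0 i).
Proof. by apply: measurable_continuous_rV => x; exact: coord_continuous. Qed.

Lemma measurable_rV_cons n : measurable_fun setT (@rV_cons n).
Proof.
apply: measurable_fun_rV => i; rewrite /rV_cons.
under eq_fun do rewrite mxE.
case: unliftP => [j _|_]; last exact: measurable_fst.
exact: (measurableT_comp (measurable_rV_coord j) measurable_snd).
Qed.

Let measurable_rV_uncons n : measurable_fun setT (@rV_uncons n).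
Proof.
apply/measurable_fun_pair; first exact: measurable_rV_coord.
apply: measurable_fun_rV => i; under eq_fun do rewrite mxE.
exact: measurable_rV_coord.
Qed.

Let rV_consK n : cancel (@rV_cons n) (@rV_uncons n).
Proof.
move=> [a y]; rewrite /rV_uncons/= mxE unlift_none; congr pair.
by apply/rowP => j; rewrite !mxE liftK.
Qed.

Section rV_cons_measure.
Variables (n : nat) (mu : {sigma_finite_measure set (Rn R n) -> \bar R}).

(* product of the one-dimensional Lebesgue measure with mu, carried to
   'rV[R]_n.+1 along (a, y) |-> (a, y_0, ..., y_(n-1)) *)
Definition rV_cons_measure (A : set (Rn R n.+1)) : \bar R :=
  pushforward (lebesgue_measure \x mu)%E (@rV_cons n) A.

Let rV_cons_measure0 : rV_cons_measure set0 = 0%E.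
Proof. by rewrite /rV_cons_measure /pushforward preimage_set0 measure0. Qed.

Let rV_cons_measure_ge0 A : (0 <= rV_cons_measure A)%E.
Proof. exact: (measure_ge0 (lebesgue_measure \x mu)%E). Qed.

Let rV_cons_measure_sigma_additive : semi_sigma_additive rV_cons_measure.
Proof.
move=> F mF tF mUF; rewrite /rV_cons_measure /pushforward preimage_bigcup.
have mcons A : measurable A -> measurable (@rV_cons n @^-1` A).
  by move=> mA; rewrite -[X in measurable X]setTI; exact: measurable_rV_cons.
apply: (@measure_semi_sigma_additive _ _ _ (lebesgue_measure \x mu)%E).
- by move=> k; exact: mcons.
- apply/trivIsetP => i j _ _ ij; rewrite -preimage_setI.
  by move/trivIsetP : tF => /(_ _ _ _ _ ij) ->//; rewrite preimage_set0.
- by rewrite -preimage_bigcup; exact: mcons.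
Qed.

HB.instance Definition _ := isMeasure.Build _ _ _ rV_cons_measure
  rV_cons_measure0 rV_cons_measure_ge0 rV_cons_measure_sigma_additive.

Let rV_cons_measure_sigma_finite : sigma_finite setT rV_cons_measure.
Proof.
have /sigma_finiteP[F [FT ndF Foo]] := sigma_finiteT (@lebesgue_measure R).
have /sigma_finiteP[G [GT ndG Goo]] := sigma_finiteT mu.
pose H k := F k `*` G k.
have HT : setT = \bigcup_k H k.
  apply/esym; rewrite -subTset => -[x y] _.
  have [i _ Fx] : (\bigcup_k F k) x by rewrite -FT.
  have [j _ Gy] : (\bigcup_k G k) y by rewrite -GT.
  exists (maxn i j) => //; split => /=.
    by move: x Fx; exact/subsetPset/ndF/leq_maxl.
  by move: y Gy; exact/subsetPset/ndG/leq_maxr.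
exists (fun k => @rV_uncons n @^-1` H k).
  by rewrite -preimage_bigcup -HT preimage_setT.
move=> k; have [mF Fk] := Foo k; have [mG Gk] := Goo k; split.
  by rewrite -[X in measurable X]setTI; apply: measurable_rV_uncons => //;
    exact: measurableX.
rewrite /rV_cons_measure /pushforward -comp_preimage.
rewrite (_ : _ \o _ = id); last by apply/funext => x; exact: rV_consK.
by rewrite preimage_id product_measure1E// lte_mul_pinfty// ge0_fin_numE.
Qed.

HB.instance Definition _ := Measure_isSigmaFinite.Build _ _ _ rV_cons_measure
  rV_cons_measure_sigma_finite.

End rV_cons_measure.

Fixpoint lebesgue_rV (n : nat) : {sigma_finite_measure set (Rn R n) -> \bar R} :=
  match n return {sigma_finite_measure set (Rn R n) -> \bar R} with
  | 0 => \d_((0 : 'rV[R]_0) : Rn R 0)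
  | n'.+1 => rV_cons_measure (lebesgue_rV n')
  end.

End lebesgue_rV.

Section sphere_measure.
Context {R : realType} (n : nat).
Implicit Types A : set (Rn R n).

Lemma measurable_enorm : measurable_fun [set: Rn R n] (@enorm R n).
Proof.
apply: (measurableT_comp (continuous_measurable_fun (@sqrt_continuous R))).
apply: measurable_sum => i; apply: measurable_funX; exact: measurable_rV_coord.
Qed.

Definition unit_dir (x : Rn R n) : Rn R n := (enorm x)^-1 *: (x : 'rV[R]_n).

Lemma measurable_unit_dir : measurable_fun setT unit_dir.
Proof.
apply: measurable_fun_rV => i; rewrite /unit_dir.
under eq_fun do rewrite mxE -powR_inv1 ?sqrtr_ge0//.
apply: measurable_funM; last exact: measurable_rV_coord.
apply: (measurableT_comp (measurable_powR _)); exact: measurable_enorm.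
Qed.

Let cone A : set (Rn R n) := [set x | 0 < enorm x <= 1 /\ A (unit_dir x)].

Let measurable_cone A : measurable A -> measurable (cone A).
Proof.
move=> mA; rewrite (_ : cone A = (@enorm R n) @^-1` `]0, 1] `&` unit_dir @^-1` A).
  apply: measurableI; rewrite -[X in measurable X]setTI.
    exact: measurable_enorm.
  exact: measurable_unit_dir.
by apply/seteqP; split => x; rewrite /cone/= in_itv.
Qed.

(* Spherical Lebesgue measure: the Lebesgue measure of the cone
   {r u | u in A, 0 < r <= 1}, scaled by n *)
Definition sphere_measure A : \bar R :=
  (n%:R%:E * lebesgue_rV n [set x | (0 < enorm x <= 1)%R /\ A (unit_dir x)])%E.

Let sphere_measure0 : sphere_measure set0 = 0%E.
Proof.
rewrite /sphere_measure (_ : [set x | _] = set0) ?measure0 ?mule0//.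
by rewrite -subset0 => x [].
Qed.

Let sphere_measure_ge0 A : (0 <= sphere_measure A)%E.
Proof. by rewrite mule_ge0// measure_ge0. Qed.

Let sphere_measure_sigma_additive : semi_sigma_additive sphere_measure.
Proof.
have n0 : 0 <= n%:R :> R by [].
move=> F mF tF mUF.
have -> : sphere_measure (\bigcup_k F k) =
    mscale (NngNum n0) (lebesgue_rV n) (\bigcup_k cone (F k)).
  congr (_ * lebesgue_rV n _)%E.
  apply/seteqP; split => x [].
    by move=> x1 [k _ Fk]; exists k.
  by move=> k _ [x1 Fk]; split => //; exists k.
apply: (@measure_semi_sigma_additive _ _ _ (mscale (NngNum n0) (lebesgue_rV n))).
- by move=> k; exact: measurable_cone.
- apply/trivIsetP => i j _ _ ij; rewrite -subset0 => x [[_ Fi] [_ Fj]].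
  have : (F i `&` F j) (unit_dir x) by [].
  by move/trivIsetP : tF => /(_ i j Logic.I Logic.I ij) ->.
- by apply: bigcupT_measurable => k; exact: measurable_cone.
Qed.

HB.instance Definition _ := isMeasure.Build _ _ _ sphere_measure
  sphere_measure0 sphere_measure_ge0 sphere_measure_sigma_additive.

End sphere_measure.

Section star_bodies.
Context {R : realType} {n : nat}.
Implicit Types (K L M : set 'rV[R]_n) (u : 'rV[R]_n) (phi : R -> R).

Definition radial K u : R := sup [set c : R | 0 <= c /\ K (c *: u)].

Definition star_shaped K :=
  forall x t, K x -> 0 <= t <= 1 -> K (t *: x).

Definition star_body K :=
  [/\ compact K, star_shaped K,
      forall u, sphere u -> 0 < radial K u &
      {within sphere, continuous (radial K)}].

Definition dilates K L :=
  forall u v, sphere u -> sphere v ->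
    radial K u / radial L u = radial K v / radial L v.

Definition dual_mixed_volume (K : 'I_n -> set 'rV[R]_n) : R :=
  n%:R^-1 * \int[@sphere_measure R n]_(u in sphere) \prod_(i < n) radial (K i) u.

(* The functions of the class are defined on ]0, +oo[; here they are functions
   on R of which only the values on ]0, +oo[ matter. *)
Definition class_C phi :=
  [/\ forall t : R, 0 < t -> 0 < phi t,
      @convex_function R R^o [set` `]0, +oo[] phi,
      forall s t : R, 0 < s -> s < t -> phi t < phi s,
      phi t @[t --> 0^'+] --> +oo &
      phi t @[t --> +oo] --> (0 : R)].

Definition strictly_convex phi :=
  forall s t a : R, 0 < s -> 0 < t -> s != t -> 0 < a < 1 ->
    phi (a * s + (1 - a) * t) < a * phi s + (1 - a) * phi t.

Definition is_orlicz_harmonic_comb phi (e : R) K L M :=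
  star_body M /\
  forall u, sphere u ->
    phi (radial K u / radial M u) + e * phi (radial L u / radial M u) = phi 1.

(* A star body is determined by its radial function, so at most one M satisfies
   the predicate; set0 is a junk value. *)
Definition orlicz_harmonic_comb phi (e : R) K L : set 'rV[R]_n :=
  xget set0 [set M | is_orlicz_harmonic_comb phi e K L M].

End star_bodies.

Definition replace_first (R : realType) (n : nat) (K : 'I_n.+1 -> set 'rV[R]_n.+1)
    (M : set 'rV[R]_n.+1) : 'I_n.+1 -> set 'rV[R]_n.+1 :=
  fun i => if i == ord0 then M else K i.

(* Main.v *)
(* Write X = rho(K_1)/rho(M) and Y = rho(L_1)/rho(M), where M is the Orlicz
   harmonic combination, so that phi(X) + eps phi(Y) = phi(1) on the sphere.
   The two arguments of phi in the inequality are the means of X and Y for the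
   density rho(M) rho(K_2) ... rho(K_n), so the inequality is Jensen's.  It is
   proved with supporting lines of phi at these means: the gap between
   phi(X) + eps phi(Y) and its supporting lines is a nonnegative continuous
   function.  In the equality case its integral vanishes, hence so does the gap
   itself, because every nonempty relatively open subset of the sphere has
   positive measure; strict convexity then makes X and Y constant.

   A star body M with the required radial function exists because, phi being
   continuous and strictly decreasing, the defining equation has a unique root,
   which depends continuously on the direction. *)
From mathcomp Require Import all_boot all_order all_algebra.
From mathcomp Require Import all_classical all_reals all_analysis.
From mathcomp Require Import measurable_realfun ring lra.
Require Import Defs.

Set Implicit Arguments.
Unset Strict Implicit.
Unset Printing Implicit Defensive.

Import Order.TTheory GRing.Theory Num.Theory.
Import numFieldNormedType.Exports.

Local Open Scope classical_set_scope.
Local Open Scope ring_scope.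

(** * Convex decreasing functions and the scalar Orlicz equation *)

Section convex_on_positives.
Context {R : realType} (phi : R -> R).
Hypothesis phi_convex : @convex_function R R^o [set` `]0, +oo[] phi.

Lemma convex_combination s t a : 0 < s -> 0 < t -> 0 <= a <= 1 ->
  phi (a * s + (1 - a) * t) <= a * phi s + (1 - a) * phi t.
Proof.
move=> s0 t0 a01.
have := @phi_convex (Itv01 (andP a01).1 (andP a01).2) s t.
rewrite !convRE /=; apply.
all: by rewrite inE /= in_itv /= andbT.
Qed.

(** [c] is the convex combination of [x] and [y] with weight [(y - c) / (y - x)] on [x]; clearing
    denominators in convexity there gives the claim. *)
Lemma convex_slopes x c y : 0 < x -> x < c -> c < y ->
  (phi c - phi x) / (c - x) <= (phi y - phi c) / (y - c).
Proof.
move=> x0 xc cy.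
have yx : 0 < y - x by lra.
have a01 : 0 <= (y - c) / (y - x) <= 1.
  by rewrite divr_ge0/= ?ler_pdivrMr ?mul1r; lra.
have := convex_combination x0 (lt_trans x0 (lt_trans xc cy)) a01.
set a := (y - c) / (y - x).
have -> : a * x + (1 - a) * y = c by rewrite /a; field; lra.
rewrite -(ler_pM2r yx).
have -> : (a * phi x + (1 - a) * phi y) * (y - x) =
    (y - c) * phi x + (c - x) * phi y.
  by rewrite /a; field; lra.
move=> h; rewrite ler_pdivrMr ?subr_gt0// mulrAC ler_pdivlMr ?subr_gt0//; nra.
Qed.

(** The slope is the supremum of the secant slopes to the left of [c], which every secant slope to
    the right bounds from above. *)
Lemma convex_subgradient c : 0 < c ->
  exists s, forall x, 0 < x -> phi c + s * (x - c) <= phi x.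
Proof.
move=> c0.
pose S : set R := [set (phi c - phi x) / (c - x) | x in [set x | 0 < x < c]].
have S0 : S !=set0.
  by exists ((phi c - phi (c / 2)) / (c - c / 2)), (c / 2) => //=; lra.
have ubS y : c < y -> ubound S ((phi y - phi c) / (y - c)).
  by move=> cy _ [x /andP[x0 xc] <-]; exact: convex_slopes.
have supS : has_sup S.
  by split=> //; exists ((phi (c + 1) - phi c) / (c + 1 - c)); apply: ubS; lra.
exists (sup S) => x x0; case: (ltgtP x c) => [xc|cx|->]; last by lra.
- have : (phi c - phi x) / (c - x) <= sup S.
    by apply: sup_ubound (supS.2) _ _; exists x => //=; rewrite x0.
  by rewrite ler_pdivrMr ?subr_gt0//; lra.
- have : sup S <= (phi x - phi c) / (x - c) by apply: sup_le_ub => //; exact: ubS.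
  by rewrite ler_pdivlMr ?subr_gt0//; lra.
Qed.

(* A strictly convex function meeting its tangent at a second point would lie
   below that tangent at the midpoint. *)
Lemma strictly_convex_subgradient c s x : strictly_convex phi -> 0 < c ->
  (forall x, 0 < x -> phi c + s * (x - c) <= phi x) ->
  0 < x -> phi x <= phi c + s * (x - c) -> x = c.
Proof.
move=> sc c0 hs x0 hx; apply/eqP/negP => /negP xc.
have h2 : 0 < (2^-1 : R) < 1 by lra.
have := sc _ _ _ x0 c0 xc h2.
have := hs (2^-1 * x + (1 - 2^-1) * c).
lra.
Qed.

Hypothesis phi_decr : forall s t : R, 0 < s -> s < t -> phi t < phi s.

(** Squeeze: the supporting line at [c] bounds [phi] from below. From above, monotonicity does so to
    the right of [c], and to the left the chord over [[c / 2, c]], of slope [- B]. *)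
Lemma convex_decreasing_continuous c : 0 < c -> {for c, continuous phi}.
Proof.
move=> c0; have [s hs] := convex_subgradient c0.
pose B := (phi (c / 2) - phi c) / (c / 2).
have c20 : 0 < c / 2 by lra.
have B0 : 0 < B by rewrite divr_gt0 // subr_gt0; apply: phi_decr; lra.
have up x : c / 2 < x -> phi x <= phi c + B * `|x - c|.
  move=> cx; have [xc|] := ltP x c; last first.
    rewrite le_eqVlt => /predU1P[<-|cx'].
      by rewrite lerDl mulr_ge0 // ltW.
    by rewrite (le_trans (ltW (phi_decr c0 cx'))) // lerDl mulr_ge0 // ltW.
  have := convex_slopes c20 cx xc.
  have -> : `|x - c| = c - x by rewrite distrC gtr0_norm ?subr_gt0.
  rewrite ler_pdivrMr ?subr_gt0// mulrAC ler_pdivlMr ?subr_gt0// => h.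
  rewrite -(ler_pM2r c20).
  have -> : (phi c + B * (c - x)) * (c / 2) =
            phi c * (c / 2) + (phi (c / 2) - phi c) * (c - x).
    by rewrite /B; field; lra.
  nra.
have lip x : c / 2 < x -> `|phi c - phi x| <= (`|s| + B) * `|c - x|.
  move=> cx; have h1 := up _ cx.
  have h2 : phi c + s * (x - c) <= phi x by apply: hs; lra.
  rewrite ler_norml distrC mulrDl; apply/andP; split.
    have : 0 <= `|s| * `|x - c| by rewrite mulr_ge0.
    lra.
  have h3 : - (s * (x - c)) <= `|s| * `|x - c| by rewrite -normrM -normrN ler_norm.
  have : 0 <= B * `|x - c| by rewrite mulr_ge0 // ltW.
  lra.
have B1 : 0 < `|s| + B by rewrite ltr_wpDl.
apply/cvgrPdist_le => e e0; near=> x.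
rewrite (le_trans (lip x _))//.
  by near: x; apply: lt_nbhsr; lra.
rewrite -ler_pdivlMl // mulrC; near: x.
apply: cvgr_dist_le; first exact: cvg_id.
by rewrite divr_gt0.
Unshelve. all: by end_near. Qed.

End convex_on_positives.

(** * Existence and comparison of roots of the scalar Orlicz equation *)

Section orlicz_equation.
Context {R : realType} (phi : R -> R) (e : R).
Hypothesis phiC : class_C phi.
Hypothesis e0 : 0 < e.
Implicit Types a b m : R.

Let phi_decr s t : 0 < s -> s < t -> phi t < phi s.
Proof. by case: phiC => _ _ + _ _; exact. Qed.

Let phi_noninc s t : 0 < s -> s <= t -> phi t <= phi s.
Proof. by move=> s0; rewrite le_eqVlt => /predU1P[->//|st]; exact/ltW/phi_decr. Qed.

Lemma orlicz_root_exists a b : 0 < a -> 0 < b ->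
  exists2 m, 0 < m & phi (a / m) + e * phi (b / m) = phi 1.
Proof.
move=> a0 b0; case: phiC => phi_gt0 phi_cvx _ phi0 phioo.
have [T [T0 phiT]] : exists T, 0 < T /\ (1 + e) * phi T < phi 1.
  have q0 : 0 < phi 1 / (1 + e) by rewrite divr_gt0 ?phi_gt0// addr_gt0.
  have : \forall t \near +oo, 0 < t /\ (1 + e) * phi t < phi 1.
    near=> t; split; first by near: t; exact: nbhs_pinfty_gt.
    rewrite mulrC -ltr_pdivlMr ?addr_gt0//; near: t.
    exact: (cvgr_lt _ phioo).
  by move=> /filter_ex.
have [d [d0 phid]] : exists d, 0 < d /\ phi 1 < phi d.
  have : \forall t \near 0^'+, 0 < t /\ phi 1 < phi t.
    near=> t; split; first by near: t; exact: nbhs_right_gt.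
    near: t; move/cvgryPgt : phi0; exact.
  by move=> /filter_ex.
pose F m := phi (a / m) + e * phi (b / m).
(* At [m0] both ratios are at least [T], so [F m0 <= (1 + e) * phi T]; at [m1] the first ratio is
   [d], so its term alone exceeds [phi 1]. *)
pose m0 := Num.min a b / T; pose m1 := a / d.
have min0 : 0 < Num.min a b by rewrite lt_min a0.
have m00 : 0 < m0 by rewrite divr_gt0.
have m10 : 0 < m1 by rewrite divr_gt0.
have Fm0 : F m0 < phi 1.
  apply: le_lt_trans phiT; rewrite /F mulrDl mul1r lerD//.
    by apply: phi_noninc => //; rewrite ler_pdivlMr// /m0 mulrC divfK ?gt_eqF// ge_min lexx.
  rewrite ler_pM2l//; apply: phi_noninc => //.
  by rewrite ler_pdivlMr// /m0 mulrC divfK ?gt_eqF// ge_min lexx orbT.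
have Fm1 : phi 1 < F m1.
  have ad : a / m1 = d by rewrite /m1; field; lra.
  apply: (lt_trans phid); rewrite /F ad ltrDl mulr_gt0// phi_gt0// divr_gt0//.
have m01 : m0 <= m1.
  rewrite leNgt; apply/negP => m10'.
  have : F m1 <= F m0.
    rewrite /F lerD// ?ler_pM2l//; apply: phi_noninc; rewrite ?divr_gt0//.
      by rewrite ler_pM2l// lef_pV2 ?posrE// ltW.
    by rewrite ler_pM2l// lef_pV2 ?posrE// ltW.
  lra.
have Fc : {within `[m0, m1], continuous F}.
  apply: continuous_in_subspaceT => m; rewrite inE/= in_itv/= => /andP[mm _].
  have mp : 0 < m by lra.
  have divc x : {for m, continuous (fun m => x / m)}.
    by apply: cvgM; [exact: cvg_cst|apply: cvgV; [lra|exact: cvg_id]].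
  apply: cvgD; last apply: cvgM; first last.
  - apply: (@continuous_comp _ _ _ (fun m => b / m) phi); first exact: divc.
    by apply: convex_decreasing_continuous => //; rewrite divr_gt0.
  - exact: cvg_cst.
  apply: (@continuous_comp _ _ _ (fun m => a / m) phi); first exact: divc.
  by apply: convex_decreasing_continuous => //; rewrite divr_gt0.
have [|m] := @IVT _ F m0 m1 (phi 1) m01 Fc.
  by rewrite ge_min le_max (ltW Fm0) (ltW Fm1) orbT.
by rewrite in_itv/= => /andP[m0m _] Fm; exists m => //; lra.
Unshelve. all: by end_near. Qed.

(* Monotonicity and 1-homogeneity of the root in (a, b), in a form which gives
   the continuity of the root in (a, b) without estimates on phi. *)
Lemma orlicz_root_le a b m a' b' m' t : 0 < a' -> 0 < b' -> 0 < m -> 0 < m' ->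
  0 < t -> a' <= t * a -> b' <= t * b ->
  phi (a / m) + e * phi (b / m) = phi 1 ->
  phi (a' / m') + e * phi (b' / m') = phi 1 -> m' <= t * m.
Proof.
move=> a0 b0 m0 m'0 t0 aa bb hm hm'; rewrite leNgt; apply/negP => mm.
have tm0 : 0 < t * m by rewrite mulr_gt0.
(* If [t * m < m'], both arguments of [phi] drop strictly from [m] to [m'], so the equation cannot
   hold for both roots. *)
have lt x x' : 0 < x' -> x' <= t * x -> phi (x / m) < phi (x' / m').
  move=> x0 xx; apply: phi_decr; first by rewrite divr_gt0.
  rewrite ltr_pdivrMr// -[X in X < _]mulr1 mulrAC ltr_pdivlMr// mulr1.
  have xp : 0 < x by rewrite -(pmulr_rgt0 _ t0); lra.
  rewrite (@le_lt_trans _ _ (t * x * m)) ?ler_pM2r//.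
  by rewrite mulrAC mulrC ltr_pM2l.
have := lt _ _ a0 aa; have := lt _ _ b0 bb.
rewrite -(ltr_pM2l e0); lra.
Qed.

End orlicz_equation.

(** * The Euclidean norm and the spherical measure *)

(** Serves both the sum under the root in [enorm] and the product of radial functions. *)
Lemma cvg_bigop (T I : Type) (V : topologicalType) (F : set_system T) {FF : Filter F}
    (op : V -> V -> V) (idx : V) (r : seq I) (f : I -> T -> V) (l : I -> V) :
  (forall g h a b, g @ F --> a -> h @ F --> b ->
    op (g x) (h x) @[x --> F] --> op a b) ->
  (forall i, f i @ F --> l i) ->
  \big[op/idx]_(i <- r) f i x @[x --> F] --> \big[op/idx]_(i <- r) l i.
Proof.
move=> opF fl; elim: r => [|i r IH].
  by rewrite big_nil; under eq_fun do rewrite big_nil; exact: cvg_cst.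
by rewrite big_cons; under eq_fun do rewrite big_cons; exact: opF.
Qed.

Section euclidean_norm.
Context {R : realType} {n : nat}.
Implicit Types (x u : 'rV[R]_n) (c : R).

Lemma enormZ c x : enorm (c *: x) = `|c| * enorm x.
Proof.
rewrite /enorm -sqrtr_sqr -sqrtrM ?sqr_ge0// mulr_sumr.
by congr Num.sqrt; apply: eq_bigr => i _; rewrite mxE exprMn.
Qed.

Lemma continuous_enorm : continuous (@enorm R n).
Proof.
move=> x; rewrite /enorm.
apply: (@continuous_comp _ _ _ (fun x : 'rV[R]_n => \sum_(i < n) x 0 i ^+ 2)
  Num.sqrt).
  apply: (@cvg_bigop _ _ _ (nbhs x)) => [g h a b|i]; first exact: cvgD.
  apply: (@continuous_comp _ _ _ (fun x : 'rV[R]_n => x 0 i) (fun t => t ^+ 2)).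
    exact: coord_continuous.
  exact: exprn_continuous.
exact: sqrt_continuous.
Qed.

Lemma coord_le_enorm x i : `|x 0 i| <= enorm x.
Proof.
rewrite /enorm -sqrtr_sqr ler_wsqrtr//.
by rewrite (bigD1 i)//= lerDl sumr_ge0// => j _; exact: sqr_ge0.
Qed.

Lemma norm_le_enorm x : `|x| <= enorm x.
Proof.
rewrite /Num.norm/= mx_normE.
(* The sup norm is a maximum taken among nonnegative numbers, so the right side is repackaged as
   one. *)
rewrite -[leRHS]/((NngNum (sqrtr_ge0 (\sum_(i < n) x 0 i ^+ 2)))%:num) num_le.
apply/bigmax_leP; split=> [|[i j] _]; first by rewrite -num_le/= sqrtr_ge0.
by rewrite -num_le/= (ord1 i) coord_le_enorm.
Qed.

Lemma compact_sphere : compact (@sphere R n).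
Proof.
apply: bounded_closed_compact.
  exists 1; split; first exact: num_real.
  by move=> M M1 x xS /=; rewrite (le_trans (norm_le_enorm _))// xS ltW.
rewrite (_ : sphere = (@enorm R n) @^-1` [set 1])//.
by apply: closed_comp; [move=> x _; exact: continuous_enorm|exact: closed_eq].
Qed.

Lemma continuous_unit_dir x : enorm x != 0 ->
  {for x, continuous (@unit_dir R n : 'rV[R]_n -> 'rV[R]_n)}.
Proof.
move=> x0.
have h : (enorm y)^-1 @[y --> x] --> (enorm x)^-1.
  exact: (@cvgV _ _ _ (nbhs_filter x) _ _ x0 (continuous_enorm (x:=x))).
exact: (@cvgZ _ _ _ _ (nbhs_filter x) _ _ _ _ h (@cvg_id _ (nbhs x))).
Qed.

End euclidean_norm.

Lemma measurable_rV_ball (R : realType) n (x : 'rV[R]_n) (r : R) :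
  measurable (ball x r : set (Rn R n)).
Proof. apply: measurable_open_rV. exact: (@ball_open R 'rV[R]_n x r). Qed.

(** Balls of the sup norm are cubes: each coordinate contributes an interval of length [2 r]. In
    dimension 0 the Dirac mass of the only point gives the empty product. *)
Lemma lebesgue_rV_ball (R : realType) n (x : 'rV[R]_n) (r : R) : 0 < r ->
  lebesgue_rV n (ball x r : set (Rn R n)) = ((r *+ 2) ^+ n)%:E.
Proof.
move=> r0; elim: n x => [|n IH] x.
  rewrite /= diracE mem_set ?expr0// (_ : 0 = x); first exact: ballxx.
  by apply/rowP => -[].
pose y : 'rV[R]_n := \row_j x 0 (lift ord0 j).
have -> : lebesgue_rV n.+1 (ball x r) =
    (lebesgue_measure \x lebesgue_rV n)%E
      ((ball (x 0 ord0) r : set (measurableTypeR R)) `*` (ball y r : set (Rn R n))).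
  rewrite /= /rV_cons_measure /pushforward; congr (_ _).
  apply/seteqP; split => -[a b] /=.
    move=> [_ h]; split; first by have := h 0 ord0; rewrite mxE unlift_none.
    split=> // i j; rewrite (ord1 i).
    by have := h 0 (lift ord0 j); rewrite !mxE liftK.
  move=> [h1 [_ h2]]; split=> // i j; rewrite (ord1 i) mxE.
  case: unliftP => [k ->|->//].
  by have := h2 0 k; rewrite mxE.
rewrite product_measure1E; [|exact: measurable_ball|exact: measurable_rV_ball].
rewrite IH exprS EFinM; congr (_ * _)%E.
exact: (lebesgue_measure_ball _ (ltW r0)).
Qed.

(** * Finiteness and positivity of the spherical measure; integrals of continuous functions *)

Section spherical_measure.
Context {R : realType} {n : nat}.
Notation S := (@sphere R n.+1).
Notation mu := (@sphere_measure R n.+1).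

Lemma measurable_sphere : measurable (S : set (Rn R n.+1)).
Proof.
rewrite (_ : sphere = (@enorm R n.+1) @^-1` [set 1])// -[X in measurable X]setTI.
exact: measurable_enorm.
Qed.

Let measurable_cone (A : set (Rn R n.+1)) : measurable A ->
  measurable [set x : Rn R n.+1 | 0 < enorm x <= 1 /\ A (unit_dir x)].
Proof.
move=> mA; rewrite (_ : [set x | _] =
  (@enorm R n.+1) @^-1` `]0, 1] `&` (@unit_dir R n.+1) @^-1` A).
  apply: measurableI; rewrite -[X in measurable X]setTI.
    exact: measurable_enorm.
  exact: measurable_unit_dir.
by apply/seteqP; split => x; rewrite /= in_itv.
Qed.

(** The cone over the sphere lies in the Euclidean unit ball, hence in a cube of finite volume. *)
Lemma sphere_measure_finite : (mu S < +oo)%E.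
Proof.
rewrite /sphere_measure lte_mul_pinfty// ?lee_fin//.
apply: (@le_lt_trans _ _
  (lebesgue_rV n.+1 (ball (0 : 'rV[R]_n.+1) 2 : set (Rn R n.+1)))).
  apply: le_measure; rewrite ?inE.
  - by apply: measurable_cone; exact: measurable_sphere.
  - exact: measurable_rV_ball.
  - move=> x [/andP[_ x1] _]; rewrite -ball_normE /= sub0r normrN.
    by rewrite (le_lt_trans (norm_le_enorm _))// (le_lt_trans x1)// ltr1n.
by rewrite lebesgue_rV_ball// ltry.
Qed.

(** The point [u / 2] is interior to the cone over this cap, since [enorm] and [unit_dir] are
    continuous there; the cone thus contains a cube of positive volume. *)
Lemma sphere_measure_ball_gt0 (u : 'rV[R]_n.+1) d : S u -> 0 < d ->
  (0 < mu (S `&` ball u d))%E.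
Proof.
move=> Su d0; rewrite /sphere_measure mule_gt0// ?lte_fin//.
pose x : 'rV[R]_n.+1 := 2^-1 *: u.
have xE : enorm x = 2^-1 by rewrite enormZ Su mulr1 gtr0_norm.
have ux : unit_dir x = u.
  by rewrite /unit_dir xE /x scalerA invrK mulfV// scale1r.
have [r /= r0 xr] : exists2 r, 0 < r & ball x r `<=`
    [set y | 0 < enorm y <= 1 /\ (S `&` ball u d) (unit_dir y)].
  apply/nbhs_ballP; near=> y.
  have y01 : 0 < enorm y <= 1.
    apply/andP; split.
      near: y; apply: (cvgr_gt (enorm x)); first exact: continuous_enorm.
      by rewrite xE.
    near: y; apply: (cvgr_le (enorm x)); first exact: continuous_enorm.
    by rewrite xE; lra.
  split=> //; split.
    case/andP: y01 => y0 _.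
    by rewrite /sphere/= /unit_dir enormZ gtr0_norm ?invr_gt0// mulVf ?gt_eqF.
  near: y.
  have : nbhs (unit_dir x : 'rV[R]_n.+1) (ball u d).
    by rewrite ux; exact: nbhsx_ballx.
  by move: (ball u d); apply: continuous_unit_dir; rewrite xE; lra.
apply: (@lt_le_trans _ _ (lebesgue_rV n.+1 (ball x r : set (Rn R n.+1)))).
  by rewrite lebesgue_rV_ball// lte_fin exprn_gt0// mulrn_wgt0.
apply: le_measure => //; rewrite ?inE.
- exact: measurable_rV_ball.
- apply: (@measurable_cone (S `&` ball u d)); apply: measurableI.
    exact: measurable_sphere.
  exact: measurable_rV_ball.
Unshelve. all: by end_near. Qed.

Lemma measurable_within_sphere (f : 'rV[R]_n.+1 -> R) :
  {within S, continuous f} -> measurable_fun (S : set (Rn R n.+1)) f.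
Proof.
move=> cf; apply: (measurability _ (RGenOInfty.measurableE R)).
move=> _ [_ [a ->] <-].
have /open_subspaceP[V oV VS] : open (f @^-1` `]a, +oo[ : set (subspace S)).
  by move/continuousP : cf; apply; exact: interval_open.
rewrite setIC -VS; apply: measurableI; last exact: measurable_sphere.
exact: measurable_open_rV.
Qed.

Lemma integrable_within_sphere (f : 'rV[R]_n.+1 -> R) :
  {within S, continuous f} -> mu.-integrable S (EFin \o f).
Proof.
move=> cf; apply: measurable_bounded_integrable.
- exact: measurable_sphere.
- exact: sphere_measure_finite.
- exact: measurable_within_sphere.
- have [M [Mr hM]] :=
    compact_bounded (continuous_compact cf (@compact_sphere R n.+1)).
  by exists M; split => // x Mx y Sy; apply: hM => //; exists y.
Qed.

(** By continuity [f] exceeds [f u / 2] on a cap around [u], which has positive measure. *)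
Lemma Rintegral_sphere_gt0 (f : 'rV[R]_n.+1 -> R) u :
  {within S, continuous f} -> (forall v, S v -> 0 <= f v) -> S u -> 0 < f u ->
  0 < \int[mu]_(v in S) f v.
Proof.
move=> cf f0 Su fu.
have [d d0 fd] : exists2 d, 0 < d & forall v, ball u d v -> S v -> f u / 2 < f v.
  have /subspace_continuousP/(_ _ Su) fuc := cf.
  have : \forall v \near within S (nbhs u), f u / 2 < f v.
    by apply: (cvgr_gt (f u)) => //; lra.
  by move=> /nbhs_ballP[d d0 h]; exists d => // v; exact: h.
pose A := S `&` ball u d.
have mA : measurable (A : set (Rn R n.+1)).
  apply: measurableI; first exact: measurable_sphere.
  exact: measurable_rV_ball.
have AS : A `<=` S by move=> v [].
have fi := integrable_within_sphere cf.
have cE : (\int[mu]_(v in A) (f u / 2)%:E <= \int[mu]_(v in S) (f v)%:E)%E.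
  apply: (@le_trans _ _ (\int[mu]_(v in A) (f v)%:E)%E).
    apply: ge0_le_integral => //.
    - by move=> v _; rewrite lee_fin; lra.
    - apply/measurable_EFinP.
      apply: measurable_funS (measurable_within_sphere cf) => //.
      exact: measurable_sphere.
    - by move=> v [Sv uv]; rewrite lee_fin ltW// fd.
  apply: ge0_subset_integral => //.
  - exact: measurable_sphere.
  - by apply/measurable_EFinP; exact: measurable_within_sphere.
rewrite integral_cst// in cE.
(* Finiteness is needed to pass from the extended integral to the real one, as [fine] sends infinity
   to 0. *)
have fin : (\int[mu]_(v in S) (f v)%:E)%E \is a fin_num.
  by apply: integrable_fin_num fi; exact: measurable_sphere.
rewrite -lte_fin /Rintegral fineK//; apply: lt_le_trans cE.
by rewrite mule_gt0 ?lte_fin ?sphere_measure_ball_gt0//; lra.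
Qed.

End spherical_measure.

(** * Orlicz harmonic combinations *)

(** The body is the image of the compact set [[0, 1] * sphere] under [(t, u) |-> t m(u) u]. *)
Lemma star_body_of_radial (R : realType) n (m : 'rV[R]_n -> R) :
  {within sphere, continuous m} -> (forall u, sphere u -> 0 < m u) ->
  exists2 M, star_body M & forall u, sphere u -> radial M u = m u.
Proof.
move=> cm m0.
pose f (p : R * 'rV[R]_n) := (p.1 * m p.2) *: p.2.
pose M := f @` (`[0, 1] `*` sphere).
have radM u : sphere u -> radial M u = m u.
  move=> Su; rewrite /radial (_ : [set c | _] = `[0, m u]%classic).
    by rewrite sup_itvcc// ltW// m0.
  apply/seteqP; split => c /=; rewrite in_itv/=.
    move=> [c0 [[t v] [/= t01 Sv]]]; rewrite in_itv/= in t01.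
    move/andP: t01 => [t0 t1] fc; rewrite c0/=.
    have cE : c = t * m v.
      have := congr1 (@enorm R n) fc; rewrite !enormZ Su Sv !mulr1.
      by rewrite !ger0_norm// mulr_ge0// ltW// m0.
    (* The origin carries no direction: [v = u] can be recovered only for [c > 0], and [c <= 0] is
       trivial. *)
    have [c_gt0|cn0] := ltP 0 c; last by rewrite (le_trans cn0)// ltW// m0.
    have <- : v = u.
      move: fc; rewrite /f/= -cE => /(congr1 ( *:%R c^-1)).
      by rewrite !scalerA mulVf ?gt_eqF// !scale1r.
    by rewrite cE ler_piMl// ltW// m0.
  move=> /andP[c0 cm0]; split=> //.
  have mu0 := m0 _ Su.
  exists (c / m u, u); last by rewrite /f/= divfK ?gt_eqF.
  by split=> //=; rewrite in_itv/= divr_ge0 ?(ltW mu0)// ler_pdivrMr// mul1r.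
exists M => //; split.
- apply: continuous_compact; last first.
    by apply: compact_setX; [exact: segment_compact|exact: compact_sphere].
  apply/subspace_continuousP => -[t u] [_ /= Su].
  have c1 : p.1 @[p --> within (`[0, 1] `*` sphere) (nbhs (t, u))] --> t.
    by apply: cvg_within_filter; exact: cvg_fst.
  have c2 : p.2 @[p --> within (`[0, 1] `*` sphere) (nbhs (t, u))] --> u.
    by apply: cvg_within_filter; exact: cvg_snd.
  (* [m] is continuous only along the sphere, where the second coordinate stays within the
     product. *)
  have c3 : m p.2 @[p --> within (`[0, 1] `*` sphere) (nbhs (t, u))] --> m u.
    move/subspace_continuousP/(_ _ Su) : cm; apply: cvg_comp => W mW.
    have h : nbhs (t, u) (fun p => sphere p.2 -> W p.2).
      have c : p.2 @[p --> (t, u)] --> u by exact: cvg_snd.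
      exact: (c _ mW).
    change (nbhs (t, u) (fun p => (`[0, 1] `*` sphere) p -> W p.2)).
    by apply: filterS h => p Wp [_ /Wp].
  exact: (cvgZ (cvgM c1 c3) c2).
- move=> _ t [[s u] [/= s01 Su] <-] /andP[t0 t1].
  exists (t * s, u); last by rewrite /f/= scalerA mulrA.
  split=> //=; move: s01; rewrite !in_itv/= => /andP[s0 s1].
  by rewrite mulr_ge0//= mulr_ile1.
- by move=> u Su; rewrite radM// m0.
- apply: subspace_eq_continuous cm => u; rewrite inE => Su.
  exact: (esym (radM _ Su)).
Qed.

Section orlicz_harmonic_combination.
Context {R : realType} {n : nat} (phi : R -> R) (e : R).
Hypotheses (phiC : class_C phi) (e0 : 0 < e).

(** Near [u] the values of [a] and [b] change by factors in [[1 - d, 1 + d]], and by comparison of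
    roots so does [m]. *)
Lemma orlicz_root_within_continuous (a b m : 'rV[R]_n -> R) :
  {within sphere, continuous a} -> {within sphere, continuous b} ->
  (forall u, sphere u -> 0 < a u) -> (forall u, sphere u -> 0 < b u) ->
  (forall u, sphere u -> 0 < m u) ->
  (forall u, sphere u -> phi (a u / m u) + e * phi (b u / m u) = phi 1) ->
  {within sphere, continuous m}.
Proof.
move=> ca cb a0 b0 m0 mE; apply/subspace_continuousP => u Su.
have nearly (f : 'rV[R]_n -> R) d : {within sphere, continuous f} ->
    0 < f u -> 0 < d ->
    \forall v \near within sphere (nbhs u), (1 - d) * f u <= f v <= (1 + d) * f u.
  move=> /subspace_continuousP/(_ _ Su) cf fu d0; near=> v.
  have : `|f u - f v| <= d * f u.
    by near: v; apply: cvgr_dist_le => //; rewrite mulr_gt0.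
  by rewrite ler_distl; lra.
apply/cvgrPdist_le => eps eps0.
(* The bound 1/2 keeps [1 - d] positive; the other makes the relative error [d] an absolute error of
   at most [eps]. *)
pose d := Num.min 2^-1 (eps / m u).
have mu0 := m0 _ Su.
have d0 : 0 < d by rewrite lt_min divr_gt0//; lra.
have d2 : d <= 2^-1 by rewrite ge_min lexx.
have dm : d * m u <= eps by rewrite -ler_pdivlMr// ge_min lexx orbT.
have Ha := nearly a d ca (a0 _ Su) d0; have Hb := nearly b d cb (b0 _ Su) d0.
near=> v.
have Sv : sphere v by near: v; exact: withinT.
have /andP[a1 a2] : (1 - d) * a u <= a v <= (1 + d) * a u by near: v.
have /andP[b1 b2] : (1 - d) * b u <= b v <= (1 + d) * b u by near: v.
have d1 : 0 < 1 - d by lra.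
have dp : 0 < 1 + d by lra.
have up := orlicz_root_le phiC e0 (a0 _ Sv) (b0 _ Sv) mu0 (m0 _ Sv) dp a2 b2
  (mE _ Su) (mE _ Sv).
(* The lower bound comes from exchanging [u] and [v], with factor [(1 - d)^-1]. *)
have := @orlicz_root_le _ _ _ phiC e0 (a v) (b v) (m v) (a u) (b u) (m u) (1 - d)^-1
  (a0 _ Su) (b0 _ Su) (m0 _ Sv) mu0.
rewrite invr_gt0 => /(_ d1); rewrite !ler_pdivlMl//.
move=> /(_ a1 b1 (mE _ Sv) (mE _ Su)) lo.
by rewrite ler_distl /from_subspace; lra.
Unshelve. all: by end_near. Qed.

(** Once some such body exists, [xget] returns one instead of [set0]. *)
Lemma orlicz_harmonic_combP (K L : set 'rV[R]_n) : star_body K -> star_body L ->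
  is_orlicz_harmonic_comb phi e K L (orlicz_harmonic_comb phi e K L).
Proof.
move=> [_ _ K0 cK] [_ _ L0 cL].
suff h : exists M, is_orlicz_harmonic_comb phi e K L M by exact: (xgetPex set0 h).
have /choice[m mP] : forall u, exists m, sphere u ->
    0 < m /\ phi (radial K u / m) + e * phi (radial L u / m) = phi 1.
  (* Off the sphere 0 is a placeholder. *)
  move=> u; have [Su|nSu] := pselect (sphere u); last by exists 0.
  by have [m m0 mE] := orlicz_root_exists phiC e0 (K0 _ Su) (L0 _ Su); exists m.
have m0 u : sphere u -> 0 < m u by move=> /mP[].
have mE u : sphere u ->
    phi (radial K u / m u) + e * phi (radial L u / m u) = phi 1.
  by move=> /mP[].
have cm := orlicz_root_within_continuous cK cL K0 L0 m0 mE.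
have [M bM rM] := star_body_of_radial cm m0.
by exists M; split=> // u Su; rewrite rM// mE.
Qed.

End orlicz_harmonic_combination.

(** * The dual Orlicz-Brunn-Minkowski inequality *)

Section dual_orlicz.
Context {R : realType} {n : nat} (phi : R -> R) (e : R).
Hypotheses (phiC : class_C phi) (e0 : 0 < e).
Notation S := (@sphere R n.+1).
Local Notation I f := (\int[@sphere_measure R n.+1]_(u in S) f u).
(** These stand for the radial functions of [K_1], [L_1] and their combination, and for the product
    of those of the remaining bodies. *)
Variables a b m p : 'rV[R]_n.+1 -> R.
Hypotheses (ca : {within S, continuous a}) (cb : {within S, continuous b}).
Hypotheses (cm : {within S, continuous m}) (cp : {within S, continuous p}).
Hypotheses (a0 : forall u, S u -> 0 < a u) (b0 : forall u, S u -> 0 < b u).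
Hypotheses (m0 : forall u, S u -> 0 < m u) (p0 : forall u, S u -> 0 < p u).
Hypothesis mE : forall u, S u -> phi (a u / m u) + e * phi (b u / m u) = phi 1.

Let ctsM (f g : 'rV[R]_n.+1 -> R) : {within S, continuous f} ->
  {within S, continuous g} -> {within S, continuous (fun u => f u * g u)}.
Proof. by move=> cf cg u; apply: cvgM; [exact: cf|exact: cg]. Qed.

Let ctsZ (f : 'rV[R]_n.+1 -> R) k : {within S, continuous f} ->
  {within S, continuous (fun u => k * f u)}.
Proof. by apply: ctsM => u; exact: cvg_cst. Qed.

Let ctsD (f g : 'rV[R]_n.+1 -> R) : {within S, continuous f} ->
  {within S, continuous g} -> {within S, continuous (fun u => f u + g u)}.
Proof. by move=> cf cg u; apply: cvgD; [exact: cf|exact: cg]. Qed.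

(** Witnesses that the sphere is nonempty and serves as base point for constant ratios. *)
Let pole : 'rV[R]_n.+1 := delta_mx 0 0.

Let sphere_pole : S pole.
Proof.
rewrite /sphere/= /enorm (bigD1 ord0)//= big1 => [|i i0].
  by rewrite mxE !eqxx expr1n addr0 sqrtr1.
by rewrite mxE (negbTE i0) andbF expr0n.
Qed.

Let I_gt0 (f : 'rV[R]_n.+1 -> R) : {within S, continuous f} ->
  (forall u, S u -> 0 < f u) -> 0 < I f.
Proof.
move=> cf f0; apply: (Rintegral_sphere_gt0 cf _ sphere_pole); last exact: f0.
by move=> v Sv; rewrite ltW// f0.
Qed.

Let I_comb (f g h : 'rV[R]_n.+1 -> R) x y z : {within S, continuous f} ->
  {within S, continuous g} -> {within S, continuous h} ->
  I (fun u => x * f u + y * g u + z * h u) = x * I f + y * I g + z * I h.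
Proof.
move=> cf cg ch.
rewrite !RintegralD ?RintegralZl//;
  solve [exact: measurable_sphere | apply: integrable_within_sphere;
    repeat first [exact: ctsZ|apply: ctsD| by []]].
Qed.

(** The means of [a / m] and [b / m] for the density proportional to [m p], with [m] cancelled in
    the numerators. *)
Let Iam := I (fun u => a u * p u) / I (fun u => m u * p u).
Let Ibm := I (fun u => b u * p u) / I (fun u => m u * p u).

Let Im_gt0 : 0 < I (fun u => m u * p u).
Proof. by apply: I_gt0 => [|u Su]; [exact: ctsM|rewrite mulr_gt0 ?m0 ?p0]. Qed.

Let Iam_gt0 : 0 < Iam.
Proof.
rewrite divr_gt0//; apply: I_gt0 => [|u Su]; first exact: ctsM.
by rewrite mulr_gt0 ?a0 ?p0.
Qed.

Let Ibm_gt0 : 0 < Ibm.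
Proof.
rewrite divr_gt0//; apply: I_gt0 => [|u Su]; first exact: ctsM.
by rewrite mulr_gt0 ?b0 ?p0.
Qed.

(* Jensen's inequality for the density m p / int m p, through tangent lines:
   G below is m p times the nonnegative gap between phi(a/m) + e phi(b/m) and
   its tangent at the means, and the linear terms integrate to 0. *)
Lemma dual_orlicz_jensen :
  phi Iam + e * phi Ibm <= phi 1 /\
  (strictly_convex phi -> phi 1 = phi Iam + e * phi Ibm ->
    forall u, S u -> a u / m u = Iam /\ b u / m u = Ibm).
Proof.
have [_ phi_cvx _ _ _] := phiC.
have [s hs] := convex_subgradient phi_cvx Iam_gt0.
have [t ht] := convex_subgradient phi_cvx Ibm_gt0.
set D := phi 1 - (phi Iam + e * phi Ibm).
(* The equation [mE] has removed [phi (a u / m u)] and [phi (b u / m u)], leaving a linear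
   combination of three continuous products. *)
pose G u := (D + s * Iam + e * t * Ibm) * (m u * p u) +
  (- s) * (a u * p u) + (- (e * t)) * (b u * p u).
have cG : {within S, continuous G}.
  by apply: ctsD; [apply: ctsD|]; apply: ctsZ; exact: ctsM.
have IG : I G = D * I (fun u => m u * p u).
  by rewrite /G I_comb; [rewrite /Iam /Ibm; field; rewrite gt_eqF|exact: ctsM..].
have GE u : S u -> G u = m u * p u *
    ((phi (a u / m u) - (phi Iam + s * (a u / m u - Iam))) +
     e * (phi (b u / m u) - (phi Ibm + t * (b u / m u - Ibm)))).
  by move=> Su; rewrite /G /D -(mE Su); field; rewrite gt_eqF ?m0.
have gapa u : S u -> 0 <= phi (a u / m u) - (phi Iam + s * (a u / m u - Iam)).
  by move=> Su; rewrite subr_ge0 hs// divr_gt0 ?a0 ?m0.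
have gapb u : S u -> 0 <= phi (b u / m u) - (phi Ibm + t * (b u / m u - Ibm)).
  by move=> Su; rewrite subr_ge0 ht// divr_gt0 ?b0 ?m0.
have mp0 u : S u -> 0 < m u * p u by move=> Su; rewrite mulr_gt0 ?m0 ?p0.
have G0 u : S u -> 0 <= G u.
  move=> Su; rewrite GE// mulr_ge0 ?(ltW (mp0 _ Su))//.
  by rewrite addr_ge0 ?gapa// mulr_ge0 ?gapb// ltW.
split.
  rewrite -subr_ge0 -/D -(pmulr_lge0 _ Im_gt0) -IG.
  exact: Rintegral_ge0.
move=> sc eqphi u Su.
have Gu : G u <= 0.
  rewrite leNgt; apply/negP => /(Rintegral_sphere_gt0 cG G0 Su).
  by rewrite IG /D eqphi subrr mul0r ltxx.
move: Gu; rewrite GE// pmulr_rle0 ?mp0// => gap0.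
have := gapa _ Su; have := gapb _ Su; set gb := phi (b u / m u) - _ in gap0 *.
set ga := phi (a u / m u) - _ in gap0 * => gb0 ga0.
have egb : 0 <= e * gb by rewrite mulr_ge0// ltW.
split.
  apply: (strictly_convex_subgradient sc Iam_gt0 hs).
    by rewrite divr_gt0 ?a0 ?m0.
  by rewrite -subr_le0 -/ga; lra.
apply: (strictly_convex_subgradient sc Ibm_gt0 ht).
  by rewrite divr_gt0 ?b0 ?m0.
by rewrite -subr_le0 -/gb -(pmulr_rle0 _ e0); lra.
Qed.

(** Proportional [a / m] and [b / m] increase together, which strict decrease of [phi] forbids under
    [mE]. Both are therefore constant, equal to their means, and [mE] at [pole] is the equality. *)
Lemma dual_orlicz_dilates :
  (forall u v, S u -> S v -> a u / b u = a v / b v) ->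
  phi 1 = phi Iam + e * phi Ibm.
Proof.
move=> dil; have [_ _ phi_decr _ _] := phiC.
have ratio u : S u -> a u / m u = a pole / b pole * (b u / m u).
  move=> Su; rewrite -(dil _ _ Su sphere_pole); field.
  by rewrite !gt_eqF ?b0 ?m0.
have k0 : 0 < a pole / b pole by rewrite divr_gt0 ?a0 ?b0.
have noless u v : S u -> S v -> ~ (b u / m u < b v / m v).
  move=> Su Sv lt_b.
  have lt_a : a u / m u < a v / m v by rewrite !ratio// ltr_pM2l.
  have phi_b : e * phi (b v / m v) < e * phi (b u / m u).
    by rewrite ltr_pM2l//; apply: phi_decr => //; rewrite divr_gt0 ?b0 ?m0.
  have phi_a : phi (a v / m v) < phi (a u / m u).
    by apply: phi_decr => //; rewrite divr_gt0 ?a0 ?m0.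
  by have := mE Su; have := mE Sv; lra.
have bcst u : S u -> b u / m u = b pole / m pole.
  move=> Su; case: (ltgtP (b u / m u) (b pole / m pole)) => // lt_b; exfalso.
    exact: noless Su sphere_pole lt_b.
  exact: noless sphere_pole Su lt_b.
have mean (f : 'rV[R]_n.+1 -> R) c : (forall u, S u -> f u / m u = c) ->
    I (fun u => f u * p u) / I (fun u => m u * p u) = c.
  move=> fc.
  have -> : I (fun u => f u * p u) = I (fun u => c * (m u * p u)).
    apply: eq_Rintegral => u; rewrite inE => Su.
    by rewrite -(fc _ Su) mulrA divfK// gt_eqF ?m0.
  rewrite RintegralZl ?mulfK// ?gt_eqF//; first exact: measurable_sphere.
  by apply: integrable_within_sphere; exact: ctsM.
rewrite /Iam /Ibm (mean b _ bcst) (mean a (a pole / m pole)) ?mE// => u Su.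
by rewrite !ratio// bcst.
Qed.

End dual_orlicz.

(* the dimension is n.+1, and K_1 is K ord0 *)
Theorem theorem6p2 (R : realType) (n : nat) (L1 : set 'rV[R]_n.+1)
    (K : 'I_n.+1 -> set 'rV[R]_n.+1) (phi : R -> R)
    (hL1 : star_body L1) (hK : forall i, star_body (K i)) (hphi : class_C phi)
    (eps : R) (heps : 0 < eps) :
  let V := dual_mixed_volume K in
  let VL := dual_mixed_volume (replace_first K L1) in
  let VM := dual_mixed_volume
    (replace_first K (orlicz_harmonic_comb phi eps (K ord0) L1)) in
  phi (V / VM) + eps * phi (VL / VM) <= phi 1 /\
  (strictly_convex phi ->
    (phi 1 = phi (V / VM) + eps * phi (VL / VM) <-> dilates (K ord0) L1)).
Proof.
have [[_ _ M0 cM] ME] := orlicz_harmonic_combP hphi heps (hK ord0) hL1.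
set M := orlicz_harmonic_comb phi eps (K ord0) L1 in M0 cM ME *.
have [_ _ L0 cL] := hL1; have [_ _ K0 cK] := hK ord0.
pose p u := \prod_(i < n) radial (K (lift ord0 i)) u.
have p0 u : sphere u -> 0 < p u.
  by move=> Su; apply: prodr_gt0 => i _; have [_ _ + _] := hK (lift ord0 i); apply.
have cp : {within sphere, continuous p}.
  move=> u; apply: cvg_bigop => [f g x y|i]; first exact: cvgM.
  by have [_ _ _ +] := hK (lift ord0 i); apply.
(* The three volumes differ only in the first body, so they share the weight [p]. *)
have VE N : dual_mixed_volume (replace_first K N) =
    n.+1%:R^-1 * \int[@sphere_measure R n.+1]_(u in sphere) (radial N u * p u).
  congr (_ * _); apply: eq_Rintegral => u _.
  rewrite big_ord_recl /replace_first eqxx.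
  by congr (_ * _); apply: eq_bigr => i _.
have replaceK : replace_first K (K ord0) = K.
  by apply/funext => i; rewrite /replace_first; case: eqP => [->|].
have divE x y : n.+1%:R^-1 * x / (n.+1%:R^-1 * y) = x / y :> R.
  by rewrite -mulf_div divff ?mul1r// invr_eq0 pnatr_eq0.
have VK := VE (K ord0); rewrite replaceK in VK.
rewrite /= VK !VE !divE.
have [ineq eqcase] := dual_orlicz_jensen hphi heps cK cL cM cp K0 L0 M0 p0 ME.
split=> // sc; split=> [/(eqcase sc) cst u v Su Sv|]; last first.
  exact: dual_orlicz_dilates.
(* The ratio of the radial functions is a quotient of two ratios that the equality case makes
   constant. *)
have ratio w : sphere w -> radial (K ord0) w / radial L1 w =
    (radial (K ord0) w / radial M w) / (radial L1 w / radial M w).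
  by move=> Sw; field; rewrite !gt_eqF ?L0 ?M0.
have [uK uL] := cst _ Su; have [vK vL] := cst _ Sv.
by rewrite !ratio// uK uL vK vL.
Qed.
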